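(* Let $\Omega=\Omega(A)$ be a differential graded algebra of classical type, let $(\ ,\ ):\Omega^1\otimes_A\Omega^1\to A$ be the inverse of a symmetric metric $g=g^1\otimes g^2\in\Omega^1\otimes_A\Omega^1$, and let $\nabla$ be a metric compatible, torsion free covariant derivative which extends to $\Omega$ as a derivation. Then the divergence operator $$\delta_\nabla=\mathfrak i_{g^1}\nabla_{g^2}:\Omega\to\Omega$$ is a degree $-1$ linear map of classical type. Its associated metric inner product is $(\ ,\ )$, and the covariant derivative $$\tfrac12\big(L_{\delta_\nabla}(\omega,\eta)+\mathcal L_\omega\eta+(\mathrm d\omega)\perp\eta\big),\qquad\omega\in\Omega^1,\ \eta\in\Omega,$$ constructed from $\delta_\nabla$ equals $\nabla_\omega\eta$.
   Context: $k$ is a field of characteristic $\neq 2$ and $A$ a unital $k$-algebra. A DGA on $A$ is an associative graded algebra $\Omega=\oplus_{n\ge0}\Omega^n$ with $\Omega^0=A$ and a graded derivation $\mathrm d:\Omega^n\to\Omega^{n+1}$, $\mathrm d^2=0$. It is standard if $\Omega^1$ is spanned by elements $a\,\mathrm db$ and $\Omega$ is generated by degrees $0,1$. It is of classical type if it is standard, graded-commutative, and equal to the tensor algebra of $\Omega^1$ over $A$ modulo the relations of antisymmetry. A degree $-1$ linear map $\delta$ on $\Omega$ is of classical type if: there is an $A$-bilinear map $\mathfrak i:\Omega^1\otimes_A\Omega^n\to\Omega^{n-1}$ with $\delta(a\omega)=a\delta\omega+\mathfrak i_{\mathrm da}\omega$; $\delta^2$ is $A$-linear; each $\mathfrak i_{\mathrm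 da}$ is a graded derivation of degree $-1$; and $\mathfrak i_{\mathrm da}(\mathrm db)=\mathfrak i_{\mathrm db}(\mathrm da)$ for all $a,b\in A$. Its associated metric inner product is $(\omega,\eta)=\mathfrak i_\omega\eta$, $\omega,\eta\in\Omega^1$. $(\ ,\ )$ is the inverse of $g=g^1\otimes g^2$ (sum of such terms understood) if $(\omega,g^1)g^2=\omega=g^1(g^2,\omega)$ for all $\omega\in\Omega^1$. Given a symmetric $A$-bilinear $(\ ,\ )$ on $\Omega^1$, $\mathfrak i_\omega$ for $\omega\in\Omega^1$ denotes the degree $-1$ graded derivation of $\Omega$ extending $(\omega,\ )$ (zero on $A$), $\mathcal L_\omega=\mathrm d\mathfrak i_\omega+\mathfrak i_\omega\mathrm d$, and $(\omega_1\cdots\omega_m)\perp(\eta_1\cdots\eta_n)=\sum_{i,j}(-1)^{i+j}(\omega_i,\eta_j)\omega_1\cdots\widehat{\omega_i}\cdots\omega_m\eta_1\cdots\widehat{\eta_j}\cdots\eta_n$ for $\omega_i,\eta_j\in\Omega^1$ (zero if an argument has degree $0$). For a degree $-1$ map $B$, $L_B(\omega,\eta)=B(\omega\eta)-(B\omega)\eta-(-1)^{|\omega|}\omega B\eta$. A covariant derivative is a bilinear map $\nabla:\Omega^1\times\Omega\to\Omega$, $\nabla_\omega$ preserving degree, with $\nabla_{a\omega}=a\nabla_\omega$ and $\nabla_\omega(a\eta)=a\nabla_\omega\eta+(\omega,\mathrm da)\eta$. It is metric compatible if $(\omega,\mathrm d(\eta,\zeta))=(\nabla_\omega\eta,\zeta)+(\eta,\nabla_\omega\zeta)$,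 and torsion free if $(\omega,\nabla_\eta\zeta)-(\eta,\nabla_\omega\zeta)=\mathfrak i_\omega\mathfrak i_\eta\mathrm d\zeta$, for all $\omega,\eta,\zeta\in\Omega^1$. *)

(* Defs.v *)
From HB Require Import structures.
From mathcomp Require Import all_boot all_algebra.
From mathcomp Require Import boolp classical_sets.

Set Implicit Arguments.
Unset Strict Implicit.
Unset Printing Implicit Defensive.

Import GRing.Theory.
Local Open Scope quotient_scope.
Local Open Scope ring_scope.

(* The tensor algebra T_A(M) of an A-bimodule M, built as the ring of formal
   expressions in the elements of A and M modulo the least ring congruence that
   makes A -> T_A(M) a ring map and M -> T_A(M) a map of A-bimodules.  The
   actions [l] and [r] of A on M are explicit parameters.  Products m (x) m' of
   two elements of M in T_A(M) are taken over A, and the part spanned by them is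
   M (x)_A M. *)
Section TensorAlgebra.
Variables (A : nzRingType) (M : zmodType) (l : A -> M -> M) (r : M -> A -> M).

Inductive texpr : Type :=
| TScal of A
| TVect of M
| TAdd of texpr & texpr
| TMul of texpr & texpr.

Inductive tcong : texpr -> texpr -> Prop :=
| tc_refl s : tcong s s
| tc_sym s t : tcong s t -> tcong t s
| tc_trans s t u : tcong s t -> tcong t u -> tcong s u
| tc_add s s' t t' : tcong s s' -> tcong t t' -> tcong (TAdd s t) (TAdd s' t')
| tc_mul s s' t t' : tcong s s' -> tcong t t' -> tcong (TMul s t) (TMul s' t')
| tc_addA s t u : tcong (TAdd s (TAdd t u)) (TAdd (TAdd s t) u)
| tc_addC s t : tcong (TAdd s t) (TAdd t s)
| tc_add0 s : tcong (TAdd (TScal 0) s) s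
| tc_mulA s t u : tcong (TMul s (TMul t u)) (TMul (TMul s t) u)
| tc_mul1l s : tcong (TMul (TScal 1) s) s
| tc_mul1r s : tcong (TMul s (TScal 1)) s
| tc_mul0l s : tcong (TMul (TScal 0) s) (TScal 0)
| tc_mulDl s t u : tcong (TMul (TAdd s t) u) (TAdd (TMul s u) (TMul t u))
| tc_mulDr s t u : tcong (TMul s (TAdd t u)) (TAdd (TMul s t) (TMul s u))
| tc_scalD a b : tcong (TScal (a + b)) (TAdd (TScal a) (TScal b))
| tc_scalM a b : tcong (TScal (a * b)) (TMul (TScal a) (TScal b))
| tc_vectD m n : tcong (TVect (m + n)) (TAdd (TVect m) (TVect n))
| tc_vectl a m : tcong (TVect (l a m)) (TMul (TScal a) (TVect m))
| tc_vectr m a : tcong (TVect (r m a)) (TMul (TVect m) (TScal a)).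

HB.instance Definition _ := gen_eqMixin texpr.
HB.instance Definition _ := gen_choiceMixin texpr.

Definition tcongb : rel texpr := fun s t => `[< tcong s t >].

Lemma tcongb_refl : reflexive tcongb.
Proof. by move=> s; apply/asboolP; apply: tc_refl. Qed.

Lemma tcongb_sym : symmetric tcongb.
Proof.
by move=> s t; apply/idP/idP => /asboolP h; apply/asboolP; apply: tc_sym.
Qed.

Lemma tcongb_trans : transitive tcongb.
Proof.
move=> t s u /asboolP st /asboolP tu; apply/asboolP; exact: tc_trans st tu.
Qed.

Canonical tcongb_equiv := EquivRel tcongb tcongb_refl tcongb_sym tcongb_trans.

Definition tensalg := {eq_quot tcongb}.

HB.instance Definition _ := Choice.on tensalg.
HB.instance Definition _ := EqQuotient.on tensalg.

Definition tens_pi (s : texpr) : tensalg := \pi_tensalg s.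

Lemma tens_piP s t : tens_pi s = tens_pi t <-> tcong s t.
Proof.
split=> [/eqmodP/asboolP // | h]; by apply/eqmodP/asboolP.
Qed.

Lemma tens_repr s : tcong (repr (tens_pi s)) s.
Proof. by apply/tens_piP; rewrite /tens_pi reprK. Qed.

Lemma tens_ind (P : tensalg -> Prop) :
  (forall s, P (tens_pi s)) -> forall x, P x.
Proof. by move=> h x; rewrite -[x]reprK; apply: h. Qed.

Definition tens_add (x y : tensalg) := tens_pi (TAdd (repr x) (repr y)).
Definition tens_mul (x y : tensalg) := tens_pi (TMul (repr x) (repr y)).
Definition tens_opp (x : tensalg) := tens_pi (TMul (TScal (-1)) (repr x)).

Lemma tens_addE s t : tens_add (tens_pi s) (tens_pi t) = tens_pi (TAdd s t).
Proof. by apply/tens_piP; apply: tc_add; apply: tens_repr. Qed.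

Lemma tens_mulE s t : tens_mul (tens_pi s) (tens_pi t) = tens_pi (TMul s t).
Proof. by apply/tens_piP; apply: tc_mul; apply: tens_repr. Qed.

Lemma tens_oppE s : tens_opp (tens_pi s) = tens_pi (TMul (TScal (-1)) s).
Proof.
by apply/tens_piP; apply: tc_mul; [apply: tc_refl | apply: tens_repr].
Qed.

Fact tens_addA : associative tens_add.
Proof.
elim/tens_ind => s; elim/tens_ind => t; elim/tens_ind => u.
by rewrite !tens_addE; apply/tens_piP; apply: tc_addA.
Qed.

Fact tens_addC : commutative tens_add.
Proof.
elim/tens_ind => s; elim/tens_ind => t.
by rewrite !tens_addE; apply/tens_piP; apply: tc_addC.
Qed.

Fact tens_add0 : left_id (tens_pi (TScal 0)) tens_add.
Proof.
by elim/tens_ind => s; rewrite tens_addE; apply/tens_piP; apply: tc_add0.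
Qed.

Fact tens_addN : left_inverse (tens_pi (TScal 0)) tens_opp tens_add.
Proof.
elim/tens_ind => s; rewrite tens_oppE tens_addE; apply/tens_piP.
apply: (@tc_trans _ (TMul (TAdd (TScal (-1)) (TScal 1)) s)).
  apply: tc_trans (tc_sym (tc_mulDl _ _ _)).
  by apply: tc_add; [apply: tc_refl | apply/tc_sym/tc_mul1l].
apply: tc_trans (tc_mul0l s); apply: tc_mul (tc_refl s).
by apply: tc_sym; rewrite -(addNr 1); apply: tc_scalD.
Qed.

HB.instance Definition _ :=
  GRing.isZmodule.Build tensalg tens_addA tens_addC tens_add0 tens_addN.

Fact tens_mulA : associative tens_mul.
Proof.
elim/tens_ind => s; elim/tens_ind => t; elim/tens_ind => u.
by rewrite !tens_mulE; apply/tens_piP; apply: tc_mulA.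
Qed.

Fact tens_mul1l : left_id (tens_pi (TScal 1)) tens_mul.
Proof.
by elim/tens_ind => s; rewrite tens_mulE; apply/tens_piP; apply: tc_mul1l.
Qed.

Fact tens_mul1r : right_id (tens_pi (TScal 1)) tens_mul.
Proof.
by elim/tens_ind => s; rewrite tens_mulE; apply/tens_piP; apply: tc_mul1r.
Qed.

Fact tens_mulDl : left_distributive tens_mul (@GRing.add tensalg).
Proof.
elim/tens_ind => s; elim/tens_ind => t; elim/tens_ind => u.
rewrite /GRing.add /= !(tens_mulE, tens_addE).
by apply/tens_piP; apply: tc_mulDl.
Qed.

Fact tens_mulDr : right_distributive tens_mul (@GRing.add tensalg).
Proof.
elim/tens_ind => s; elim/tens_ind => t; elim/tens_ind => u.
rewrite /GRing.add /= !(tens_mulE, tens_addE).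
by apply/tens_piP; apply: tc_mulDr.
Qed.

HB.instance Definition _ := GRing.Zmodule_isPzRing.Build tensalg
  tens_mulA tens_mul1l tens_mul1r tens_mulDl tens_mulDr.

Definition tens_scal (a : A) : tensalg := tens_pi (TScal a).
Definition tens_vect (m : M) : tensalg := tens_pi (TVect m).

End TensorAlgebra.

(* A DGA on A with underlying algebra [dga_alg].  The grading is given by the
   projections [hpart n] onto the homogeneous components, and Omega^0 is
   identified with A through [dincl]. *)
Record dga (k : fieldType) (A : algType k) := Dga {
  dga_alg :> algType k;
  hpart : nat -> {linear dga_alg -> dga_alg};
  dincl : {lrmorphism A -> dga_alg};
  ddiff : {linear dga_alg -> dga_alg};
  hpart_proj : forall m n x,
    hpart m (hpart n x) = if m == n then hpart n x else 0;
  hpart_sum : forall x, exists N : nat, x = \sum_(n < N) hpart n x;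
  hpartM : forall m n x y, hpart m x = x -> hpart n y = y ->
    hpart (m + n)%N (x * y) = x * y;
  dincl_inj : injective dincl;
  dincl_deg0 : forall x, hpart 0 x = x <-> exists a : A, x = dincl a;
  ddiff_deg : forall n x, hpart n x = x -> hpart n.+1 (ddiff x) = ddiff x;
  ddiff_leibniz : forall n x y, hpart n x = x ->
    ddiff (x * y) = ddiff x * y + (-1) ^+ n * (x * ddiff y);
  ddiff_sq : forall x, ddiff (ddiff x) = 0
}.

Section DGA.
Variables (k : fieldType) (A : algType k) (Om : dga A).
Implicit Types (a b : A) (x y : Om).

Definition homog (n : nat) : {pred Om} := [pred x | hpart Om n x == x].

Fact homog_submod n : submod_closed (homog n).
Proof.
split=> [|c x y]; rewrite !inE ?linear0 // => /eqP hx /eqP hy.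
by rewrite linearP hx hy.
Qed.

HB.instance Definition _ n :=
  GRing.isSubmodClosed.Build k Om (homog n) (homog_submod n).

Definition form1 := {x : Om | x \in homog 1}.

HB.instance Definition _ := SubChoice.on form1.
HB.instance Definition _ := [SubChoice_isSubLmodule of form1 by <:].

Fact hpart_homog n x : hpart Om n x \in homog n.
Proof. by rewrite inE hpart_proj eqxx. Qed.

(* The degree 1 component; it serves to see elements of [Om] known to be of
   degree 1 as elements of [form1]. *)
Definition to_form1 x : form1 := Sub (hpart Om 1 x) (hpart_homog 1 x).

Definition form1_lact a (w : form1) := to_form1 (dincl Om a * val w).
Definition form1_ract (w : form1) a := to_form1 (val w * dincl Om a).

Definition d1 a : form1 := to_form1 (ddiff Om (dincl Om a)).

Definition standard :=
  (forall w : form1, exists s : seq (A * A),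
     val w = \sum_(p <- s) dincl Om p.1 * ddiff Om (dincl Om p.2)) /\
  (forall x, exists s : seq (seq Om),
     all (all [predU homog 0 & homog 1]) s /\
     x = \sum_(w <- s) \prod_(y <- w) y).

Definition graded_commutative := forall m n x y,
  x \in homog m -> y \in homog n -> x * y = (-1) ^+ (m * n) * (y * x).

Definition form_tensalg := tensalg form1_lact form1_ract.

Definition form_tens (w v : form1) : form_tensalg :=
  tens_vect form1_lact form1_ract w * tens_vect form1_lact form1_ract v.

(* membership in the two-sided ideal of T_A(Omega^1) generated by the elements
   w (x) v + v (x) w *)
Definition antisym_ideal (t : form_tensalg) :=
  exists s : seq (form_tensalg * (form1 * form1) * form_tensalg),
    t = \sum_(q <- s)
          q.1.1 * (form_tens q.1.2.1 q.1.2.2 + form_tens q.1.2.2 q.1.2.1) * q.2.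

(* The canonical map T_A(Omega^1) -> Omega is onto, with kernel the
   antisymmetry ideal. *)
Definition antisym_tensor_quotient :=
  exists phi : {rmorphism form_tensalg -> Om},
    [/\ forall a, phi (tens_scal _ _ a) = dincl Om a,
        forall w, phi (tens_vect _ _ w) = val w,
        forall x, exists t, phi t = x
      & forall t, phi t = 0 <-> antisym_ideal t].

Definition dga_classical :=
  [/\ standard, graded_commutative & antisym_tensor_quotient].

(* k-linear of degree -1, with Omega^(-1) = 0 *)
Definition degm1_linear (D : Om -> Om) :=
  [/\ linear D,
      forall x, x \in homog 0 -> D x = 0
    & forall n x, x \in homog n.+1 -> D x \in homog n].

Definition graded_derivation_m1 (D : Om -> Om) :=
  degm1_linear D /\
  forall n x y, x \in homog n ->
    D (x * y) = D x * y + (-1) ^+ n * (x * D y).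

(* A bimodule map Omega^1 (x)_A Omega^n -> Omega^(n-1) for each n, written as
   a balanced map of two variables *)
Definition interior_bilinear (ii : form1 -> Om -> Om) :=
  [/\ forall x, linear (ii^~ x),
      forall w, degm1_linear (ii w),
      forall a w x, ii (form1_lact a w) x = dincl Om a * ii w x,
      forall w a x, ii (form1_ract w a) x = ii w (dincl Om a * x)
    & forall w x a, ii w (x * dincl Om a) = ii w x * dincl Om a].

Definition classical_interior (delta : Om -> Om) (ii : form1 -> Om -> Om) :=
  [/\ interior_bilinear ii,
      forall a x, delta (dincl Om a * x) = dincl Om a * delta x + ii (d1 a) x,
      forall a, graded_derivation_m1 (ii (d1 a))
    & forall a b, ii (d1 a) (val (d1 b)) = ii (d1 b) (val (d1 a))].

Definition degm1_classical (delta : Om -> Om) :=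
  [/\ degm1_linear delta,
      exists ii, classical_interior delta ii
    & forall a x, delta (delta (dincl Om a * x)) =
                  dincl Om a * delta (delta x)].

(* The map [ii] is unique when Omega is standard, hence the quantifier. *)
Definition associated_metric (delta : Om -> Om) (met : form1 -> form1 -> A) :=
  forall ii, classical_interior delta ii ->
  forall w v, dincl Om (met w v) = ii w (val v).

(* ( , ) : Omega^1 (x)_A Omega^1 -> A *)
Definition metric_bilinear (met : form1 -> form1 -> A) :=
  [/\ forall w, linear (met w : form1 -> A),
      forall v, linear (met^~ v : form1 -> A),
      forall a w v, met (form1_lact a w) v = a * met w v,
      forall w a v, met (form1_ract w a) v = met w (form1_lact a v)
    & forall w v a, met w (form1_ract v a) = met w v * a].

(* A list of pairs (g1, g2) stands for the sum of the g1 (x) g2 *)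
Definition symmetric_tensor (g : seq (form1 * form1)) :=
  \sum_(p <- g) form_tens p.1 p.2 = \sum_(p <- g) form_tens p.2 p.1.

Definition metric_inverse (met : form1 -> form1 -> A)
    (g : seq (form1 * form1)) := forall w : form1,
  \sum_(p <- g) form1_lact (met w p.1) p.2 = w /\
  \sum_(p <- g) form1_ract p.1 (met p.2 w) = w.

(* The graded derivation of degree -1 extending (w, ), selected by choice
   (0 if there is none) *)
Definition extends_contraction (met : form1 -> form1 -> A) (w : form1)
    (D : Om -> Om) :=
  graded_derivation_m1 D /\ forall v, D (val v) = dincl Om (met w v).

Definition interior (met : form1 -> form1 -> A) (w : form1) : Om -> Om :=
  xget (fun _ : Om => 0 : Om) [set D | extends_contraction met w D].

Definition lie (met : form1 -> form1 -> A) (w : form1) x :=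
  ddiff Om (interior met w x) + interior met w (ddiff Om x).

(* The bilinear operation given by the formula on products of 1-forms,
   selected by choice (0 if there is none).  Indices start from 0, which does
   not affect the sign (-1)^(i+j). *)
Definition is_perp (met : form1 -> form1 -> A) (P : Om -> Om -> Om) :=
  [/\ forall x, linear (P x),
      forall y, linear (P^~ y),
      forall x y, x \in homog 0 \/ y \in homog 0 -> P x y = 0
    & forall m n (w : 'I_m -> form1) (v : 'I_n -> form1),
      P (\prod_(i < m) val (w i)) (\prod_(j < n) val (v j)) =
      \sum_(i < m) \sum_(j < n)
        (-1) ^+ (i + j) * (dincl Om (met (w i) (v j)) *
          ((\prod_(h < m | h != i) val (w h)) *
           (\prod_(h < n | h != j) val (v h))))].

Definition perp (met : form1 -> form1 -> A) : Om -> Om -> Om :=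
  xget (fun _ _ : Om => 0 : Om) [set P | is_perp met P].

(* L_B(x, y) for x homogeneous of degree n *)
Definition leibniz_defect (B : Om -> Om) (n : nat) x y :=
  B (x * y) - B x * y - (-1) ^+ n * (x * B y).

Definition covariant_derivative (met : form1 -> form1 -> A)
    (nabla : form1 -> Om -> Om) :=
  [/\ forall w, linear (nabla w),
      forall x, linear (nabla^~ x),
      forall w n x, x \in homog n -> nabla w x \in homog n,
      forall a w x, nabla (form1_lact a w) x = dincl Om a * nabla w x
    & forall w a x, nabla w (dincl Om a * x) =
        dincl Om a * nabla w x + dincl Om (met w (d1 a)) * x].

Definition nabla1 (nabla : form1 -> Om -> Om) (w v : form1) : form1 :=
  to_form1 (nabla w (val v)).

Definition metric_compatible (met : form1 -> form1 -> A)
    (nabla : form1 -> Om -> Om) := forall w v z,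
  met w (d1 (met v z)) = met (nabla1 nabla w v) z + met v (nabla1 nabla w z).

Definition torsion_free (met : form1 -> form1 -> A)
    (nabla : form1 -> Om -> Om) := forall w v z,
  dincl Om (met w (nabla1 nabla v z) - met v (nabla1 nabla w z)) =
  interior met w (interior met v (ddiff Om (val z))).

Definition acts_by_derivations (nabla : form1 -> Om -> Om) := forall w x y,
  nabla w (x * y) = nabla w x * y + x * nabla w y.

Definition divergence (met : form1 -> form1 -> A) (g : seq (form1 * form1))
    (nabla : form1 -> Om -> Om) x :=
  \sum_(p <- g) interior met p.1 (nabla p.2 x).

Definition constructed_nabla (met : form1 -> form1 -> A)
    (delta : Om -> Om) (w : form1) y :=
  2%:R^-1 *: (leibniz_defect delta 1 (val w) y + lie met w y
              + perp met (ddiff Om (val w)) y).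

End DGA.

(* Main.v *)
(* Write i_w for the contraction with w and delta = i_{g1} nabla_{g2}.  Metric
   compatibility gives [nabla_v, i_w] = i_{nabla_v w}; since the i's anticommute,
   delta i_w + i_w delta = i_{g1} i_{nabla_{g2} w}.  For w = da, torsion freeness
   makes v |-> nabla_v w self-adjoint, so this double contraction is that of a
   symmetric tensor and vanishes (2 is invertible); hence delta^2 is A-linear.
   Expanding the products gives
     L_delta(w, y) = nabla_w y - (nabla_{g2} w) (i_{g1} y),
     x _|_ y = (i_{g1} x) (i_{g2} y),
   so the last claim reads
     L_w y + dw _|_ y = nabla_w y + (nabla_{g2} w) (i_{g1} y).
   Both sides are derivations of degree 0 in y, hence it suffices to take y in A
   and y = da, where it follows from metric compatibility, torsion freeness and
   nondegeneracy. *)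

Require Import Defs.
From HB Require Import structures.
From mathcomp Require Import all_boot all_algebra.
From mathcomp Require Import boolp classical_sets.

Set Implicit Arguments.
Unset Strict Implicit.
Unset Printing Implicit Defensive.

Import GRing.Theory.
Local Open Scope ring_scope.

(** * Additivity of plain functions that satisfy [linear] *)

Section LinearFun.
Variables (R : pzRingType) (U V : lmodType R) (D : U -> V).
Hypothesis D_linear : linear D.

Definition linear_of : {linear U -> V} :=
  HB.pack D (GRing.isLinear.Build R U V *:%R D D_linear).

Lemma linear_fun0 : D 0 = 0.
Proof. exact: raddf0 linear_of. Qed.

Lemma linear_funD x y : D (x + y) = D x + D y.
Proof. exact: raddfD linear_of x y. Qed.

Lemma linear_funN x : D (- x) = - D x.
Proof. exact: raddfN linear_of x. Qed.

Lemma linear_funB x y : D (x - y) = D x - D y.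
Proof. exact: raddfB linear_of x y. Qed.

Lemma linear_fun_sum I (s : seq I) (P : pred I) (F : I -> U) :
  D (\sum_(i <- s | P i) F i) = \sum_(i <- s | P i) D (F i).
Proof. exact: raddf_sum linear_of I s P F. Qed.

End LinearFun.

(** * Forms and the tensor algebra *)

Section TensorUniversal.
Variables (A : nzRingType) (M : zmodType) (l : A -> M -> M) (r : M -> A -> M).
Variables (B : pzRingType) (f : {rmorphism A -> B}) (h : {additive M -> B}).
Hypothesis hl : forall a m, h (l a m) = f a * h m.
Hypothesis hr : forall m a, h (r m a) = h m * f a.

Fixpoint texpr_eval (s : texpr A M) : B :=
  match s with
  | TScal a => f a
  | TVect m => h m
  | TAdd s t => texpr_eval s + texpr_eval t
  | TMul s t => texpr_eval s * texpr_eval t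
  end.

Lemma texpr_eval_cong s t : tcong l r s t -> texpr_eval s = texpr_eval t.
Proof.
elim=> {s t} /=; try by move=> *; congruence.
- by move=> s t u; rewrite addrA.
- by move=> s t; rewrite addrC.
- by move=> s; rewrite rmorph0 add0r.
- by move=> s t u; rewrite mulrA.
- by move=> s; rewrite rmorph1 mul1r.
- by move=> s; rewrite rmorph1 mulr1.
- by move=> s; rewrite rmorph0 mul0r.
- by move=> s t u; rewrite mulrDl.
- by move=> s t u; rewrite mulrDr.
- by move=> a b; rewrite rmorphD.
- by move=> a b; rewrite rmorphM.
- by move=> m n; rewrite raddfD.
Qed.

(** Every clause of [tcong] holds in B after evaluation, so evaluation of formal expressions
    descends to the quotient. This is the way to define maps out of the tensor algebra. *)
Lemma tensalg_universal : exists psi : {rmorphism tensalg l r -> B},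
  (forall a, psi (tens_scal l r a) = f a) /\
  (forall m, psi (tens_vect l r m) = h m).
Proof.
pose psi (x : tensalg l r) := texpr_eval (repr x).
have psiE s : psi (tens_pi l r s) = texpr_eval s.
  exact: texpr_eval_cong (tens_repr l r s).
have psiD : nmod_morphism psi.
  split; first by rewrite (psiE (TScal _ 0)) /= rmorph0.
  elim/tens_ind => s; elim/tens_ind => t.
  by rewrite [_ + _]tens_addE !psiE.
have psiM : monoid_morphism psi.
  split; first by rewrite (psiE (TScal _ 1)) /= rmorph1.
  elim/tens_ind => s; elim/tens_ind => t.
  by rewrite [_ * _]tens_mulE !psiE.
pose mD := GRing.isNmodMorphism.Build _ _ psi psiD.
pose mM := GRing.isMonoidMorphism.Build _ _ psi psiM.
pose F : {rmorphism tensalg l r -> B} := HB.pack psi mD mM.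
by exists F; split=> [a|m]; rewrite /= psiE.
Qed.

End TensorUniversal.

(** * Homogeneous elements and 1-forms of a DGA *)

Section Forms.
Variables (k : fieldType) (A : algType k) (Om : dga A).
Implicit Types (a b : A) (x y : Om) (u v w : form1 Om).
Local Notation "a %:O" := (dincl Om a) (at level 2, format "a %:O").
Local Notation d := (ddiff Om).
Local Notation homog := (@homog k A Om).

Lemma homog_hpart n x : x \in homog n -> hpart Om n x = x.
Proof. by move/eqP. Qed.

Lemma homogM m n x y :
  x \in homog m -> y \in homog n -> x * y \in homog (m + n).
Proof. by move=> /eqP hx /eqP hy; apply/eqP; rewrite hpartM. Qed.

Lemma dincl_homog a : a%:O \in homog 0.
Proof. by apply/eqP/dincl_deg0; exists a. Qed.

Lemma homog0P x : x \in homog 0 -> exists a, x = a%:O.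
Proof. by move/eqP/dincl_deg0. Qed.

Lemma val_homog w : val w \in homog 1.
Proof. exact: (valP w). Qed.
Hint Resolve dincl_homog val_homog : core.

Lemma val_to_form1 x : x \in homog 1 -> val (to_form1 x) = x.
Proof. by move/homog_hpart. Qed.

Lemma val_lact a w : val (form1_lact a w) = a%:O * val w.
Proof. by apply: val_to_form1; apply: (@homogM 0 1). Qed.

Lemma val_ract w a : val (form1_ract w a) = val w * a%:O.
Proof. by apply: val_to_form1; apply: (@homogM 1 0). Qed.

Lemma ddiff_homog n x : x \in homog n -> d x \in homog n.+1.
Proof. by move=> /eqP hx; apply/eqP; rewrite ddiff_deg. Qed.

Lemma val_d1 a : val (d1 Om a) = d a%:O.
Proof. by apply: val_to_form1; apply: ddiff_homog. Qed.

Lemma val_sum I (s : seq I) (F : I -> form1 Om) :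
  val (\sum_(i <- s) F i) = \sum_(i <- s) val (F i).
Proof. exact: raddf_sum. Qed.

Lemma valD v w : val (v + w) = val v + val w.
Proof. exact: raddfD. Qed.

Lemma scale_dincl (c : k) x : c *: x = (c%:A)%:O * x.
Proof. by rewrite linearZ /= rmorph1 -scalerAl mul1r. Qed.

Lemma homog_all (P : Om -> Prop) :
  P 0 -> (forall x y, P x -> P y -> P (x + y)) ->
  (forall n x, x \in homog n -> P x) -> forall x, P x.
Proof.
move=> P0 PD Ph x; have [N ->] := hpart_sum x.
by elim/big_ind: _ => // i _; apply: Ph; apply: hpart_homog.
Qed.

(** * Classical type: commutation, induction on forms and the universal property *)

Section Classical.
Hypothesis clOm : dga_classical Om.

Lemma dinclC a x : a%:O * x = x * a%:O.
Proof.
have [_ gc _] := clOm; elim/homog_all: x => [|x y ex ey|n x hx].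
- by rewrite mulr0 mul0r.
- by rewrite mulrDr mulrDl ex ey.
- by rewrite (gc 0 n) // mul0n mul1r.
Qed.

(** Graded commutativity in degree 0, pulled back along the injective [dincl]. *)
Lemma coefC a b : a * b = b * a.
Proof. by apply: (@dincl_inj _ _ Om); rewrite !rmorphM dinclC. Qed.

Lemma ractE w a : form1_ract w a = form1_lact a w.
Proof. by apply: val_inj; rewrite val_ract val_lact dinclC. Qed.

Lemma val_anticomm v w : val v * val w = - (val w * val v).
Proof. by have [_ gc _] := clOm; rewrite (gc 1 1)%N // muln1 expr1 mulN1r. Qed.

Lemma homog_ind (P : nat -> Om -> Prop) :
  (forall n, P n 0) -> (forall n x y, P n x -> P n y -> P n (x + y)) ->
  P 0 1 -> (forall n a x, P n x -> P n (a%:O * x)) ->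
  (forall n w x, x \in homog n -> P n x -> P n.+1 (val w * x)) ->
  forall n x, x \in homog n -> P n x.
Proof.
move=> P0 PD P1 Pa Pw n x hx; have [[_ /(_ x)[s [hs ex]]] _ _] := clOm.
have word (t : seq Om) : all [predU homog 0 & homog 1] t ->
    exists m, \prod_(y <- t) y \in homog m /\ P m (\prod_(y <- t) y).
  elim: t => [_|y t IHt /= /andP[hy /IHt [m [hm Pm]]]].
    by exists 0; rewrite big_nil; split=> //; rewrite -(rmorph1 (dincl Om)) dincl_homog.
  rewrite big_cons; move: hy => /orP[/homog0P [a ->]|hy].
    by exists m; split; [rewrite -[m]add0n; apply: homogM | apply: Pa].
  exists m.+1; split; first by rewrite -add1n; apply: homogM.
  by rewrite -(val_to_form1 hy); apply: Pw.
(* Standardness gives words of mixed degrees. Projecting to degree n keeps those of degree n and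
   sends the others to 0, where P holds in every degree. *)
rewrite -(homog_hpart hx) ex linear_sum.
elim: s hs {ex} => [|t s IHs] /=; first by rewrite big_nil.
move=> /andP[/word [m [hm Pm]] /IHs hs]; rewrite big_cons; apply: PD => //.
by rewrite -(homog_hpart hm) hpart_proj; case: eqP => [->|//]; rewrite homog_hpart.
Qed.

Lemma form_ind (P : Om -> Prop) :
  P 0 -> (forall x y, P x -> P y -> P (x + y)) ->
  P 1 -> (forall a x, P x -> P (a%:O * x)) ->
  (forall w x, P x -> P (val w * x)) -> forall x, P x.
Proof.
move=> P0 PD P1 Pa Pw; apply: homog_all => // n x.
by apply: (@homog_ind (fun _ => P)) => // _ w y _; apply: Pw.
Qed.

Lemma form1_span w : exists s : seq (A * A),
  w = \sum_(p <- s) form1_lact p.1 (d1 Om p.2).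
Proof.
have [[/(_ w)[s es] _] _ _] := clOm; exists s; apply: val_inj.
rewrite es val_sum; apply: eq_bigr => p _.
by rewrite val_lact val_d1.
Qed.

(** The extension of f and h to the tensor algebra kills the antisymmetry ideal, which is the kernel
    of the surjection [phi] onto Omega; it therefore factors through [phi]. *)
Lemma classical_universal (B : pzRingType) (f : {rmorphism A -> B})
    (h : {additive form1 Om -> B}) :
  (forall a w, h (form1_lact a w) = f a * h w) ->
  (forall w a, h (form1_ract w a) = h w * f a) ->
  (forall v w, h v * h w + h w * h v = 0) ->
  exists F : {rmorphism Om -> B},
    (forall a, F a%:O = f a) /\ (forall w, F (val w) = h w).
Proof.
move=> hl hr hanti; have [psi [psia psiw]] := tensalg_universal hl hr.
have [_ _ [phi [phia phiw phionto phiker]]] := clOm.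
have eq_psi s t : phi s = phi t -> psi s = psi t.
  move=> est; apply/eqP; rewrite -subr_eq0 -rmorphB.
  have /phiker [e ->] : phi (s - t) = 0 by rewrite rmorphB est subrr.
  rewrite rmorph_sum big1 // => q _.
  by rewrite !(rmorphM, rmorphD) !psiw hanti mulr0 mul0r.
pose rep x := projT1 (cid (phionto x)).
have repK x : phi (rep x) = x := projT2 (cid (phionto x)).
pose F x := psi (rep x).
have FE t : F (phi t) = psi t by apply: eq_psi; rewrite repK.
have FD : nmod_morphism F.
  split=> [|x y]; first by rewrite -(rmorph0 phi) FE rmorph0.
  by rewrite -(repK x) -(repK y) -rmorphD !FE rmorphD.
have FM : monoid_morphism F.
  split=> [|x y]; first by rewrite -(rmorph1 phi) FE rmorph1.
  by rewrite -(repK x) -(repK y) -rmorphM !FE rmorphM.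
pose mD := GRing.isNmodMorphism.Build _ _ F FD.
pose mM := GRing.isMonoidMorphism.Build _ _ F FM.
pose F' : {rmorphism Om -> B} := HB.pack F mD mM.
by exists F'; split=> [a|w] /=; rewrite -?phia -?phiw FE ?psia ?psiw.
Qed.

(** In positive degree the coefficient of a product can be absorbed into its first factor. The
    result has the shape of the products in [is_perp]. *)
Lemma homog_span n x : x \in homog n.+1 ->
  exists s : seq ('I_n.+1 -> form1 Om), x = \sum_(w <- s) \prod_(i < n.+1) val (w i).
Proof.
have span m y : y \in homog m -> exists s : seq (A * ('I_m -> form1 Om)),
    y = \sum_(q <- s) q.1%:O * \prod_(i < m) val (q.2 i).
  move: m y; apply: homog_ind.
  - by move=> m; exists [::]; rewrite big_nil.
  - by move=> m _ _ [s ->] [t ->]; exists (s ++ t); rewrite big_cat.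
  - by exists [:: (1, fun _ => 0)]; rewrite big_seq1 big_ord0 rmorph1 mulr1.
  - move=> m a _ [s ->]; exists [seq (a * q.1, q.2) | q <- s].
    by rewrite big_map mulr_sumr; apply: eq_bigr => q _; rewrite rmorphM mulrA.
  - move=> m w _ _ [s ->].
    (* The new family has w at index 0, followed by the old family shifted by one. *)
    exists [seq (q.1, fun i => oapp q.2 w (unlift ord0 i)) | q <- s].
    rewrite big_map mulr_sumr; apply: eq_bigr => q _.
    rewrite big_ord_recl /= unlift_none /= mulrA -dinclC -mulrA.
    by congr (_ * (_ * _)); apply: eq_bigr => i _; rewrite liftK.
move=> /span [s ->].
exists [seq (fun i => if i == ord0 then form1_lact q.1 (q.2 ord0) else q.2 i) | q <- s].
rewrite big_map; apply: eq_bigr => q _.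
by rewrite !big_ord_recl eqxx val_lact mulrA.
Qed.

(** * Upper triangular matrices over Omega and the existence of contractions *)

Definition tri2 x y z : 'M[Om]_2 :=
  \matrix_(i, j) (if i == 0 then if j == 0 then x else y
                  else if j == 0 then 0 else z).

Lemma mulmx2E (M N : 'M[Om]_2) i j :
  (M * N) i j = M i 0 * N 0 j + M i 1 * N 1 j.
Proof.
rewrite mxE big_ord_recl big_ord1; congr (_ + M i _ * N _ j); exact: val_inj.
Qed.

Lemma tri2E x y z : ((tri2 x y z 0 0 = x) * (tri2 x y z 0 1 = y) *
  (tri2 x y z 1 0 = 0) * (tri2 x y z 1 1 = z))%type.
Proof. by rewrite !mxE. Qed.

Lemma eq_mx2 (M N : 'M[Om]_2) : M 0 0 = N 0 0 -> M 0 1 = N 0 1 ->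
  M 1 0 = N 1 0 -> M 1 1 = N 1 1 -> M = N.
Proof.
have I2 (i : 'I_2) : i = 0 \/ i = 1.
  by case: i => [[|[]//] hi]; [left | right]; apply: val_inj.
by move=> h00 h01 h10 h11; apply/matrixP=> i j; case: (I2 i) (I2 j) => -> [] ->.
Qed.

Definition coef_mx2 : {rmorphism A -> 'M[Om]_2} := (@scalar_mx Om 2) \o dincl Om.

Lemma coef_mx2E a : coef_mx2 a = tri2 a%:O 0 a%:O.
Proof. by apply: eq_mx2; rewrite !mxE ?mulr1n ?mulr0n. Qed.

(* With c = -1 this produces the contraction by f; with c = 0 it reads off
   f(v) w from the tensor product of v and w. *)
Section FormMx2.
Variables (c : Om) (f : {additive form1 Om -> A}).

Definition form_mx2 w : 'M[Om]_2 := tri2 (c * val w) (f w)%:O (val w).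

Fact form_mx2_is_additive : zmod_morphism form_mx2.
Proof.
move=> v w; apply: eq_mx2;
  by rewrite !mxE /= ?raddfB ?rmorphB ?mulrBr ?subrr //= mulrBr.
Qed.

HB.instance Definition _ :=
  GRing.isZmodMorphism.Build _ _ form_mx2 form_mx2_is_additive.

Hypothesis cC : forall x, c * x = x * c.
Hypothesis f_lact : forall a w, f (form1_lact a w) = a * f w.

Lemma form_mx2_lact a w : form_mx2 (form1_lact a w) = coef_mx2 a * form_mx2 w.
Proof.
rewrite coef_mx2E; apply: eq_mx2; rewrite mulmx2E !tri2E ?(mul0r, mulr0, addr0, add0r) //.
- by rewrite val_lact mulrA cC -!mulrA.
- by rewrite f_lact rmorphM.
- by rewrite val_lact.
Qed.

Lemma form_mx2_ract w a : form_mx2 (form1_ract w a) = form_mx2 w * coef_mx2 a.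
Proof.
rewrite coef_mx2E; apply: eq_mx2; rewrite mulmx2E !tri2E ?(mul0r, mulr0, addr0, add0r) //.
- by rewrite val_ract mulrA.
- by rewrite ractE f_lact rmorphM dinclC.
- by rewrite val_ract.
Qed.

End FormMx2.

(* In M_2(Om), forms of degree n act through ((-1)^n x, D x; 0, x), so that the
   Leibniz rule of the graded derivation D is multiplicativity. *)
Lemma contraction_exists (f : {additive form1 Om -> A}) :
  (forall a w, f (form1_lact a w) = a * f w) ->
  exists D, graded_derivation_m1 D /\ forall v, D (val v) = (f v)%:O.
Proof.
move=> fl; have cC x : -1 * x = x * -1 by rewrite mulN1r mulrN1.
have [v w|F [Fa Fw]] := @classical_universal _ coef_mx2 (form_mx2 (-1) f)
    (form_mx2_lact cC fl) (form_mx2_ract (-1) fl).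
  (* The diagonal vanishes because 1-forms anticommute. The corner is -v f(w) + f(v) w - w f(v) +
     f(w) v, which is 0 because coefficients are central. *)
  apply: eq_mx2; rewrite mxE !mulmx2E !tri2E !mxE ?(mul0r, mulr0, addr0, add0r) //.
  - by rewrite !mulN1r !mulrNN val_anticomm addNr.
  - by rewrite !mulN1r !mulNr !dinclC addrACA -opprD [X in _ + X]addrC addNr.
  - by rewrite val_anticomm addNr.
have FP n x : x \in homog n -> [/\ F x 0 0 = (-1) ^+ n * x, F x 1 0 = 0,
    F x 1 1 = x & if n is m.+1 then F x 0 1 \in homog m else F x 0 1 = 0].
  move: n x; apply: homog_ind.
  - by move=> n; rewrite rmorph0 !mxE mulr0; split=> //; case: n => // n; rewrite rpred0.
  - move=> n x y [x1 x2 x3 x4] [y1 y2 y3 y4].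
    rewrite rmorphD !mxE x1 x2 x3 y1 y2 y3 addr0 mulrDr; split=> //.
    by case: n x4 y4 {x1 y1} => [->->|n hx hy]; rewrite ?addr0 ?rpredD.
  - by rewrite rmorph1 !mxE mulr1.
  - move=> n a x [x1 x2 x3 x4]; rewrite rmorphM Fa coef_mx2E !mulmx2E !tri2E.
    rewrite !mul0r !(addr0, add0r) x1 x2 x3 mulr0; split=> //.
      by rewrite !mulrA [_%:O * _]dinclC.
    by case: n x4 {x1} => [->|n hx]; rewrite ?mulr0 //; apply: (@homogM 0).
  - move=> n w x hx [x1 x2 x3 x4]; rewrite rmorphM Fw !mulmx2E !tri2E.
    rewrite !mul0r !(addr0, add0r) x1 x2 x3 mulr0 addr0; split=> //.
      by rewrite exprS -!mulrA !mulN1r; congr (- _); rewrite mulrA commr_sign -mulrA.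
      by rewrite mulr0.
    rewrite /=; apply: rpredD; last exact: (@homogM 0).
    rewrite mulN1r mulNr rpredN.
    case: n x4 {x1 hx} => [->|n hx]; first by rewrite mulr0; apply: rpred0.
    exact: homogM (val_homog w) hx.
(* The Leibniz rule allows an inhomogeneous second factor, so this entry is needed for all y. *)
have F11 y : F y 1 1 = y.
  elim/homog_all: y => [|x y ex ey|n x /FP[]//]; first by rewrite rmorph0 mxE.
  by rewrite rmorphD mxE ex ey.
exists (fun x => F x 0 1); split=> [|v]; last by rewrite Fw tri2E.
split=> [|n x y /FP[x1 _ _ _]]; last by rewrite rmorphM mulmx2E x1 F11 addrC mulrA.
split=> [c x y|x /FP[]//|n x /FP[]//].
rewrite [c *: x]scale_dincl rmorphD rmorphM Fa coef_mx2E mxE mulmx2E.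
by rewrite !tri2E mul0r addr0 -scale_dincl.
Qed.

(** * Interior products and the inverse metric *)

Section Metric.
Variable met : form1 Om -> form1 Om -> A.
Hypothesis met_bilin : metric_bilinear met.
Local Notation "\i_ w" := (interior met w) (at level 8, w at level 2, format "\i_ w").

Lemma met_linear w : linear (met w : form1 Om -> A).
Proof. by case: met_bilin. Qed.

Lemma met_linearl v : linear (met^~ v : form1 Om -> A).
Proof. by case: met_bilin. Qed.

Lemma met_lactl a w v : met (form1_lact a w) v = a * met w v.
Proof. by case: met_bilin. Qed.

Lemma met_lactr w a v : met w (form1_lact a v) = a * met w v.
Proof.
by case: met_bilin => _ _ _ _ h; rewrite -ractE h coefC.
Qed.

(** The default value in [interior] never occurs, since [contraction_exists] applies to the A-linear
    map [met w]. *)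
Lemma interiorP w : extends_contraction met w \i_w.
Proof.
rewrite /interior; case: xgetP => [D _ //|noD].
have [D hD] := @contraction_exists (linear_of (met_linear w)) (met_lactr w).
by case: (noD D).
Qed.

Lemma interior_linear w : linear \i_w.
Proof. by case: (interiorP w) => [[[]]]. Qed.

Definition interiorD w := linear_funD (interior_linear w).
Definition interiorN w := linear_funN (interior_linear w).
Definition interior0 w := linear_fun0 (interior_linear w).
Definition interior_sum w := linear_fun_sum (interior_linear w).

Lemma interior_deg0 w x : x \in homog 0 -> \i_w x = 0.
Proof. by case: (interiorP w) => [[[_ h _]] _] _; apply: h. Qed.

Lemma interior_dincl w a : \i_w a%:O = 0.
Proof. by rewrite interior_deg0. Qed.

Lemma interior1 w : \i_w 1 = 0.
Proof. by rewrite -(rmorph1 (dincl Om)) interior_dincl. Qed.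

Lemma interior_homog w n x : x \in homog n.+1 -> \i_w x \in homog n.
Proof. by case: (interiorP w) => [[[_ _ h] _] _]; apply: h. Qed.

Lemma interiorM w n x y : x \in homog n ->
  \i_w (x * y) = \i_w x * y + (-1) ^+ n * (x * \i_w y).
Proof. by case: (interiorP w) => [[_ h] _]; apply: h. Qed.

Lemma interior_val w v : \i_w (val v) = (met w v)%:O.
Proof. by case: (interiorP w). Qed.

Lemma interior_lact w a x : \i_w (a%:O * x) = a%:O * \i_w x.
Proof. by rewrite (@interiorM w 0) // interior_dincl mul0r add0r mul1r. Qed.

Lemma interior_valM w v x :
  \i_w (val v * x) = (met w v)%:O * x - val v * \i_w x.
Proof. by rewrite (@interiorM w 1) // interior_val mulN1r. Qed.

Lemma interiorDl v w x : \i_(v + w) x = \i_v x + \i_w x.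
Proof.
elim/form_ind: x => [|x y ex ey||a x ex|u x ex].
- by rewrite !interior0 addr0.
- by rewrite !interiorD ex ey addrACA.
- by rewrite !interior1 addr0.
- by rewrite !interior_lact ex mulrDr.
- rewrite !interior_valM ex (linear_funD (met_linearl u)) rmorphD.
  by rewrite mulrDr mulrDl opprD addrACA.
Qed.

Lemma interior_lactl a w x : \i_(form1_lact a w) x = a%:O * \i_w x.
Proof.
elim/form_ind: x => [|x y ex ey||b x ex|u x ex].
- by rewrite !interior0 mulr0.
- by rewrite !interiorD ex ey mulrDr.
- by rewrite !interior1 mulr0.
- by rewrite !interior_lact ex mulrA -rmorphM coefC rmorphM mulrA.
- rewrite !interior_valM ex met_lactl rmorphM mulrBr !mulrA.
  by rewrite (dinclC a (val u)).
Qed.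

Lemma interior_sum_lactl I (s : seq I) (c : I -> A) (w : I -> form1 Om) x :
  \i_(\sum_(i <- s) form1_lact (c i) (w i)) x = \sum_(i <- s) (c i)%:O * \i_(w i) x.
Proof.
elim: s => [|i s IHs]; last by rewrite !big_cons interiorDl IHs interior_lactl.
rewrite !big_nil -[X in interior _ X](_ : form1_lact 0 0 = 0).
  by rewrite interior_lactl rmorph0 mul0r.
by apply: val_inj; rewrite val_lact rmorph0 mul0r.
Qed.

(** In the induction step, i_v i_w (u x) = (w,u) i_v x - (v,u) i_w x + u i_v i_w x, which is
    antisymmetric in v and w as soon as i_v i_w x is. *)
Lemma interior_anticomm v w x : \i_v (\i_w x) = - \i_w (\i_v x).
Proof.
elim/form_ind: x => [|x y ex ey||a x ex|u x ex].
- by rewrite !interior0 oppr0.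
- by rewrite !interiorD ex ey opprD.
- by rewrite !interior1 !interior0 oppr0.
- by rewrite !interior_lact ex mulrN.
- rewrite !interior_valM !interiorD !interiorN !interior_lact !interior_valM ex.
  by rewrite mulrN !opprD !opprK addrCA; congr (_ + _).
Qed.

(** * Expansion of 1-forms in g, symmetry and nondegeneracy of the metric *)

Section Inverse.
Variable g : seq (form1 Om * form1 Om).
Hypothesis g_sym : symmetric_tensor g.
Hypothesis g_inv : metric_inverse met g.

(** The symmetry of g is an equation in the tensor algebra. The matrices [form_mx2] with c = 0
    define a ring morphism on it whose corner entry at v (x) w is f(v) w; it is applied to both
    sides. *)
Lemma symmetric_tensor_coef (f : {additive form1 Om -> A}) :
  (forall a w, f (form1_lact a w) = a * f w) ->
  \sum_(p <- g) form1_lact (f p.1) p.2 = \sum_(p <- g) form1_lact (f p.2) p.1.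
Proof.
move=> fl; have c0 x : 0 * x = x * 0 by rewrite mulr0 mul0r.
have [psi [_ psiv]] := tensalg_universal (form_mx2_lact c0 fl) (form_mx2_ract 0 fl).
apply: val_inj; rewrite !val_sum.
have tensE v w : psi (form_tens v w) 0 1 = val (form1_lact (f v) w).
  by rewrite rmorphM !psiv mulmx2E !tri2E val_lact !mul0r add0r.
under eq_bigr do rewrite -tensE; under [RHS]eq_bigr do rewrite -tensE.
by rewrite -!summxE -!rmorph_sum g_sym.
Qed.

Lemma met_expand w : w = \sum_(p <- g) form1_lact (met w p.1) p.2.
Proof. by have [->] := g_inv w. Qed.

Lemma met_expandC w : w = \sum_(p <- g) form1_lact (met p.2 w) p.1.
Proof.
have [_ {1}<-] := g_inv w.
by apply: eq_bigr => p _; rewrite ractE.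
Qed.

(** Symmetry passes from g to its inverse: expanding v with the two legs of g exchanged, and w as
    usual, turns both sides into the sum of the (g1,v)(g2,w). *)
Lemma met_sym v w : met v w = met w v.
Proof.
have e : v = \sum_(p <- g) form1_lact (met p.1 v) p.2.
  rewrite [LHS]met_expandC; apply/esym.
  exact: (@symmetric_tensor_coef (linear_of (met_linearl v))) (fun a u => met_lactl a u v).
rewrite [in LHS]e [in RHS](met_expandC w).
rewrite (linear_fun_sum (met_linearl w)) (linear_fun_sum (met_linearl v)).
by apply: eq_bigr => p _; rewrite !met_lactl coefC.
Qed.

Lemma met_nondeg v w : (forall u, met u v = met u w) -> v = w.
Proof.
move=> h; rewrite (met_expand v) (met_expand w).
by apply: eq_bigr => p _; rewrite met_sym h met_sym.
Qed.

Lemma interior_prod u m (w : 'I_m -> form1 Om) :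
  \i_u (\prod_(i < m) val (w i)) =
  \sum_(i < m) (-1) ^+ i *
    ((met u (w i))%:O * \prod_(h < m | h != i) val (w h)).
Proof.
elim: m w => [|m IHm] w; first by rewrite !big_ord0 interior1.
rewrite !big_ord_recl interior_valM IHm expr0 mul1r; congr (_ * _ + _).
  rewrite [RHS]big_mkcond [RHS]big_ord_recl /= mul1r.
  by apply: eq_bigr => i _.
(* These terms omit a later factor, so the factor at [ord0] stays; passing it costs the one sign by
   which the exponents i and i+1 differ. *)
rewrite mulr_sumr -sumrN; apply: eq_bigr => i _.
rewrite [X in _ = _ * (_ * X)]big_mkcond [X in _ = _ * (_ * X)]big_ord_recl /= -big_mkcond /=.
under [in RHS]eq_bigl => h do rewrite (inj_eq lift_inj).
rewrite exprS mulN1r mulNr !mulrA; congr (- (_ * _)).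
by rewrite commr_sign -!mulrA dinclC.
Qed.

(** * A closed form of the operation [perp] *)

Definition perp_form x y := \sum_(p <- g) \i_(p.1) x * \i_(p.2) y.

Lemma perp_form_is_perp : is_perp met perp_form.
Proof.
split=> [x c y z|y c x z|x y xy0|m n w v].
- rewrite /perp_form scaler_sumr -big_split; apply: eq_bigr => p _ /=.
  by rewrite interior_linear mulrDr scalerAr.
- rewrite /perp_form scaler_sumr -big_split; apply: eq_bigr => p _ /=.
  by rewrite interior_linear mulrDl scalerAl.
- rewrite /perp_form big1 // => p _.
  by case: xy0 => /interior_deg0 ->; rewrite ?mul0r ?mulr0.
- rewrite /perp_form; under eq_bigr do rewrite !interior_prod mulr_suml.
  rewrite exchange_big; apply: eq_bigr => i _ /=.
  under eq_bigr do rewrite mulr_sumr.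
  rewrite exchange_big; apply: eq_bigr => j _ /=.
  set W := \prod_(h < m | _) _; set V := \prod_(h < n | _) _.
  (* Expanding [w i] in g splits the inner product into one factor for each contraction. *)
  have -> : met (w i) (v j) = \sum_(p <- g) met p.1 (w i) * met p.2 (v j).
    rewrite [X in met X _](met_expand (w i)) (linear_fun_sum (met_linearl (v j))).
    by apply: eq_bigr => p _; rewrite met_lactl met_sym.
  rewrite rmorph_sum mulr_suml mulr_sumr; apply: eq_bigr => p _.
  rewrite rmorphM exprD -!mulrA; congr (_ * _).
  rewrite [W * _]mulrA commr_sign -!mulrA [_%:O * ((-1) ^+ j * _)]mulrA.
  rewrite commr_sign -!mulrA; congr (_ * (_ * _)).
  by rewrite mulrA -dinclC -mulrA.
Qed.

(** Both vanish when an argument has degree 0; in positive degrees [homog_span] reduces to products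
    of 1-forms, where the formula prescribes the value. *)
Lemma is_perp_unique (P Q : Om -> Om -> Om) :
  is_perp met P -> is_perp met Q -> forall x y, P x y = Q x y.
Proof.
move=> [Pr Pl P0 Pp] [Qr Ql Q0 Qp] x y.
elim/homog_all: x => [|x z ex ez|m x hx].
- by rewrite (linear_fun0 (Pl y)) (linear_fun0 (Ql y)).
- by rewrite (linear_funD (Pl y)) (linear_funD (Ql y)) ex ez.
elim/homog_all: y => [|y z ey ez|n y hy].
- by rewrite (linear_fun0 (Pr x)) (linear_fun0 (Qr x)).
- by rewrite (linear_funD (Pr x)) (linear_funD (Qr x)) ey ez.
case: m hx => [|m] hx; first by rewrite P0 ?Q0 //; left.
case: n hy => [|n] hy; first by rewrite P0 ?Q0 //; right.
have [s ->] := homog_span hx; have [t ->] := homog_span hy.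
rewrite (linear_fun_sum (Pl _)) (linear_fun_sum (Ql _)); apply: eq_bigr => w _.
rewrite (linear_fun_sum (Pr _)) (linear_fun_sum (Qr _)); apply: eq_bigr => v _.
by rewrite Pp Qp.
Qed.

Lemma perpE x y : perp met x y = perp_form x y.
Proof.
apply: is_perp_unique perp_form_is_perp _ _.
by rewrite /perp; case: xgetP => [P _ //|/(_ perp_form)/(_ perp_form_is_perp)].
Qed.

(** * The divergence of a covariant derivative *)

Section Covariant.
Variable nabla : form1 Om -> Om -> Om.
Hypothesis two_neq0 : 2%:R != 0 :> k.
Hypothesis nabla_cov : covariant_derivative met nabla.
Hypothesis nablaM : acts_by_derivations nabla.
Hypothesis nabla_metric : metric_compatible met nabla.
Hypothesis nabla_tors : torsion_free met nabla.

Let nabla_linear w : linear (nabla w). Proof. by case: nabla_cov. Qed.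

Let nabla_linearl x : linear (nabla^~ x). Proof. by case: nabla_cov. Qed.

Lemma nabla_lactl a w x : nabla (form1_lact a w) x = a%:O * nabla w x.
Proof. by case: nabla_cov. Qed.

Lemma nabla_homog w n x : x \in homog n -> nabla w x \in homog n.
Proof. by case: nabla_cov => _ _ h _ _; apply: h. Qed.

Lemma nabla_lact w a x :
  nabla w (a%:O * x) = a%:O * nabla w x + (met w (d1 Om a))%:O * x.
Proof. by case: nabla_cov. Qed.

Lemma nabla_val w v : nabla w (val v) = val (nabla1 nabla w v).
Proof. by rewrite val_to_form1 // nabla_homog. Qed.

Lemma nabla_1 w : nabla w 1 = 0.
Proof. by apply: (addrI (nabla w 1)); rewrite addr0 -{3}[1]mulr1 nablaM mulr1 mul1r. Qed.

Lemma nabla_dincl w a : nabla w a%:O = (met w (d1 Om a))%:O.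
Proof. by rewrite -[a%:O]mulr1 nabla_lact nabla_1 mulr0 add0r mulr1. Qed.

(** The commutator of the derivation [nabla v] with i_w is again a graded derivation of degree -1,
    so induction on products reduces the claim to 1-forms, where it is metric compatibility. *)
Lemma nabla_interior v w x :
  nabla v (\i_w x) = \i_w (nabla v x) + \i_(nabla1 nabla v w) x.
Proof.
elim/form_ind: x => [|x y ex ey||a x ex|u x ex].
- rewrite (linear_fun0 (nabla_linear v)) !interior0.
  by rewrite (linear_fun0 (nabla_linear v)) addr0.
- rewrite (linear_funD (nabla_linear v)) !interiorD.
  by rewrite (linear_funD (nabla_linear v)) ex ey addrACA.
- by rewrite nabla_1 !interior1 interior0 (linear_fun0 (nabla_linear v)) addr0.
- by rewrite nabla_lact !interior_lact nabla_lact interiorD !interior_lact ex mulrDr addrAC.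
- rewrite nablaM interiorD !nabla_val !interior_valM.
  rewrite (linear_funB (nabla_linear v)) nabla_lact nablaM ex nabla_val.
  rewrite nabla_metric rmorphD mulrDl mulrDr !opprD !addrA.
  by rewrite [RHS](ACl (3*5*1*2*4*6)).
Qed.

(** * The divergence is of classical type, with inner product [met] *)

Local Notation delta := (divergence met g nabla).

Lemma divergence_linear : linear delta.
Proof.
move=> c x y; rewrite /divergence scaler_sumr -big_split; apply: eq_bigr => p _ /=.
by rewrite nabla_linear interior_linear.
Qed.

Lemma divergence_degm1 : degm1_linear delta.
Proof.
split=> [|x hx|n x hx]; first exact: divergence_linear.
  by rewrite /divergence big1 // => p _; rewrite interior_deg0 ?nabla_homog.
by apply: rpred_sum => p _; apply: interior_homog; apply: nabla_homog.
Qed.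

(** Differentiating the coefficient contributes (g2,da) i_{g1}, which sums to i_{da}. *)
Lemma divergence_lact a x : delta (a%:O * x) = a%:O * delta x + \i_(d1 Om a) x.
Proof.
rewrite [d1 Om a]met_expandC interior_sum_lactl /divergence mulr_sumr -big_split.
apply: eq_bigr => p _ /=.
by rewrite nabla_lact interiorD !interior_lact.
Qed.

(** Symmetry of the Hessian of a: in the torsion identity for da the right side contains dda = 0. *)
Lemma nabla_exact_sym v w a :
  met v (nabla1 nabla w (d1 Om a)) = met w (nabla1 nabla v (d1 Om a)).
Proof.
have /eqP := nabla_tors v w (d1 Om a).
by rewrite val_d1 ddiff_sq !interior0 rmorphB subr_eq0 => /eqP/dincl_inj.
Qed.

Lemma eq_oppr_form x : x = - x -> x = 0.
Proof.
move/eqP; rewrite -addr_eq0 -mulr2n -scaler_nat scaler_eq0.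
by rewrite (negPf two_neq0) => /eqP.
Qed.

Lemma divergence_interior a x :
  delta (\i_(d1 Om a) x) = - \i_(d1 Om a) (delta x).
Proof.
rewrite /divergence interior_sum -sumrN.
under eq_bigr do rewrite nabla_interior interiorD interior_anticomm.
rewrite big_split /= -[RHS]addr0; congr (_ + _); apply: eq_oppr_form.
(* These are the coefficients of the Hessian of a. Exchanging p and q preserves them and reverses
   the sign of the double contraction, so the sum equals its own negative. *)
pose c (p q : form1 Om * form1 Om) := met q.2 (nabla1 nabla p.2 (d1 Om a)).
have -> : \sum_(p <- g) \i_(p.1) (\i_(nabla1 nabla p.2 (d1 Om a)) x) =
    \sum_(p <- g) \sum_(q <- g) (c p q)%:O * \i_(p.1) (\i_(q.1) x).
  apply: eq_bigr => p _; rewrite [nabla1 _ _ _]met_expandC interior_sum_lactl.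
  by rewrite interior_sum; apply: eq_bigr => q _; rewrite interior_lact.
rewrite [LHS]exchange_big -sumrN; apply: eq_bigr => p _.
rewrite -sumrN; apply: eq_bigr => q _ /=.
by rewrite /c nabla_exact_sym interior_anticomm mulrN.
Qed.

Lemma divergence_sq_lact a x :
  delta (delta (a%:O * x)) = a%:O * delta (delta x).
Proof.
rewrite divergence_lact (linear_funD divergence_linear) divergence_lact.
by rewrite divergence_interior addrK.
Qed.

Lemma scale_lact (c : k) w : c *: w = form1_lact c%:A w.
Proof. by apply: val_inj; rewrite val_lact -scale_dincl. Qed.

Lemma divergence_classical_interior : classical_interior delta (interior met).
Proof.
split=> [|a x|a|a b].
- split=> [x c v w|w|a w x|w a x|w x a].
  + by rewrite scale_lact interiorDl interior_lactl -scale_dincl.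
  + by case: (interiorP w) => [[]].
  + exact: interior_lactl.
  + by rewrite ractE interior_lactl interior_lact.
  + by rewrite -!dinclC interior_lact.
- exact: divergence_lact.
- by case: (interiorP (d1 Om a)).
- by rewrite !interior_val met_sym.
Qed.

(** The rule for delta(a x) determines [ii] on exact forms, and A-linearity in the first argument on
    their span, which is all of Omega^1. *)
Lemma divergence_associated : associated_metric delta met.
Proof.
move=> ii [[iil _ iilact _ _] iidelta _ _] w v.
have ii_d1 a x : ii (d1 Om a) x = \i_(d1 Om a) x.
  by apply: (addrI (a%:O * delta x)); rewrite -iidelta divergence_lact.
have [s ->] := form1_span w.
rewrite -interior_val (linear_fun_sum (iil _)) interior_sum_lactl.
by apply: eq_bigr => p _; rewrite iilact ii_d1.
Qed.

(** * Recovering [nabla] from the divergence *)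

Lemma nabla_sum_lactl I (s : seq I) (c : I -> A) (w : I -> form1 Om) x :
  nabla (\sum_(i <- s) form1_lact (c i) (w i)) x = \sum_(i <- s) (c i)%:O * nabla (w i) x.
Proof.
rewrite (linear_fun_sum (nabla_linearl x)).
by apply: eq_bigr => i _; rewrite nabla_lactl.
Qed.

Lemma divergence_defect w y : leibniz_defect delta 1 (val w) y =
  nabla w y - \sum_(p <- g) val (nabla1 nabla p.2 w) * \i_(p.1) y.
Proof.
rewrite /leibniz_defect expr1 mulN1r opprK.
have -> : delta (val w * y) = delta (val w) * y
    - (\sum_(p <- g) val (nabla1 nabla p.2 w) * \i_(p.1) y)
    + (nabla w y - val w * delta y).
  (* Only the w of [nabla w y] is expanded: the terms (g1,w) nabla_{g2} y of the left side sum to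
     it. *)
  rewrite {4}(met_expand w) nabla_sum_lactl /divergence mulr_suml mulr_sumr.
  rewrite -!sumrB -big_split; apply: eq_bigr => p _ /=.
  rewrite nablaM interiorD nabla_val !interior_valM interior_val.
  by rewrite (met_sym w) (homog_hpart (val_homog _)).
by rewrite !addrA [LHS](ACl ((1*5)*(4*6)*(3*2)))%AC /= subrr addNr !add0r.
Qed.

Definition derivation0 (F : Om -> Om) := linear F /\
  forall n x y, x \in homog n -> F (x * y) = F x * y + x * F y.

Lemma derivation0D F G :
  derivation0 F -> derivation0 G -> derivation0 (fun x => F x + G x).
Proof.
move=> [Fl Fd] [Gl Gd]; split=> [c x y|n x y hx].
  by rewrite Fl Gl scalerDr addrACA.
by rewrite (Fd n) // (Gd n) // mulrDl mulrDr addrACA.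
Qed.

Lemma derivation0_sum I (s : seq I) (F : I -> Om -> Om) :
  (forall i, derivation0 (F i)) -> derivation0 (fun x => \sum_(i <- s) F i x).
Proof.
move=> Fd; split=> [c x y|n x y hx].
  rewrite scaler_sumr -big_split; apply: eq_bigr => i _.
  by case: (Fd i) => ->.
rewrite mulr_suml mulr_sumr -big_split; apply: eq_bigr => i _.
by case: (Fd i) => _ /(_ n) ->.
Qed.

(** Omega is generated by the elements a and da. *)
Lemma derivation0_eq F G : derivation0 F -> derivation0 G ->
  (forall a, F a%:O = G a%:O) -> (forall a, F (d a%:O) = G (d a%:O)) -> F =1 G.
Proof.
move=> [Fl Fd] [Gl Gd] FGa FGd.
have FGv w : F (val w) = G (val w).
  have [s ->] := form1_span w; rewrite val_sum (linear_fun_sum Fl) (linear_fun_sum Gl).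
  apply: eq_bigr => p _.
  by rewrite val_lact val_d1 (Fd 0) // (Gd 0) // FGa FGd.
elim/form_ind => [|x y ex ey||a x ex|w x ex].
- by rewrite (linear_fun0 Fl) (linear_fun0 Gl).
- by rewrite (linear_funD Fl) (linear_funD Gl) ex ey.
- by rewrite -(rmorph1 (dincl Om)) FGa.
- by rewrite (Fd 0) // (Gd 0) // FGa ex.
- by rewrite (Fd 1) // (Gd 1) // FGv ex.
Qed.

Lemma form1_homogC n w x : x \in homog n -> val w * x = (-1) ^+ n * (x * val w).
Proof. by move=> hx; have [_ gc _] := clOm; rewrite (gc 1 n) // mul1n. Qed.

(** The sign from moving i_w past x cancels the sign from moving v past x. *)
Lemma form_interior_derivation0 v w : derivation0 (fun x => val v * \i_w x).
Proof.
split=> [c x y|n x y hx]; first by rewrite interior_linear mulrDr scalerAr.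
rewrite (interiorM _ _ hx) mulrDr mulrA; congr (_ + _).
rewrite [RHS]mulrA -[x * val v](signrMK n) -(form1_homogC v hx).
by rewrite [LHS]mulrA commr_sign -!mulrA.
Qed.

Lemma nabla_derivation0 w : derivation0 (nabla w).
Proof. by split=> [|n x y _]; [apply: nabla_linear | apply: nablaM]. Qed.

Lemma linear_sign (F : Om -> Om) n x :
  linear F -> F ((-1) ^+ n * x) = (-1) ^+ n * F x.
Proof.
by move=> Fl; rewrite -signr_odd !mulr_sign; case: odd; rewrite ?(linear_funN Fl).
Qed.

Lemma lie_derivation0 w : derivation0 (lie met w).
Proof.
split=> [c x y|n x y hx].
  by rewrite /lie interior_linear !linearP interior_linear scalerDr addrACA.
(* The sign is that of degree n - 1, written so as to include n = 0, where i_w x = 0. *)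
have dix : d (\i_w x * y) = d (\i_w x) * y - (-1) ^+ n * (\i_w x * d y).
  case: n hx => [|n] hx; first by rewrite interior_deg0 // !(mul0r, mulr0, linear0, addr0).
  by rewrite (ddiff_leibniz _ (homog_hpart (interior_homog w hx))) exprS mulN1r mulNr opprK.
rewrite /lie (interiorM _ _ hx) (ddiff_leibniz _ (homog_hpart hx)) linearD interiorD.
rewrite dix (interiorM _ _ (ddiff_homog hx)).
rewrite (linear_sign _ _ (interior_linear w)) (linear_sign _ _ (@linearP _ _ _ _ d)).
rewrite (interiorM _ _ hx) (ddiff_leibniz _ (homog_hpart hx)).
rewrite !mulrDr !signrMK exprS mulN1r mulNr mulrDl !addrA.
(* The mixed terms, in i_w x dy and in dx i_w y, cancel in pairs. *)
by rewrite [LHS](ACl ((2*7)*(3*6)*(1*5*4*8)))%AC /= addNr subrr !add0r.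
Qed.

Lemma constructed_nablaE w y : constructed_nabla met delta w y = nabla w y.
Proof.
have lie_perp x : lie met w x + perp_form (d (val w)) x =
    nabla w x + \sum_(p <- g) val (nabla1 nabla p.2 w) * \i_(p.1) x.
  (* As dw has degree 2, its contraction is a 1-form, so dw [perp] x is a sum of terms v i_u x and a
     derivation in x. *)
  have dw p : \i_p (d (val w)) = val (to_form1 (\i_p (d (val w)))).
    rewrite val_to_form1 //; apply: interior_homog; exact: ddiff_homog.
  move: x; apply: derivation0_eq => [||a|a].
  - apply: derivation0D; first exact: lie_derivation0.
    by apply: derivation0_sum => p; rewrite dw; apply: form_interior_derivation0.
  - apply: derivation0D; first exact: nabla_derivation0.
    by apply: derivation0_sum => p; apply: form_interior_derivation0.
  - rewrite /perp_form /lie interior_dincl linear0 add0r -val_d1 interior_val nabla_dincl.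
    by rewrite !big1 // => p _; rewrite interior_dincl mulr0.
  (* At x = da the identity reads d(w,da) + i_{da} dw = nabla_w da + nabla_{da} w. *)
  - rewrite -val_d1 /lie val_d1 ddiff_sq interior0 addr0 -!val_d1 interior_val.
    have -> : perp_form (d (val w)) (val (d1 Om a)) = \i_(d1 Om a) (d (val w)).
      rewrite [X in interior _ X (d _)]met_expandC interior_sum_lactl.
      by apply: eq_bigr => p _; rewrite interior_val -dinclC.
    have -> : \sum_(p <- g) val (nabla1 nabla p.2 w) * \i_(p.1) (val (d1 Om a)) =
        nabla (d1 Om a) (val w).
      rewrite [X in nabla X]met_expand nabla_sum_lactl.
      apply: eq_bigr => p _.
      by rewrite interior_val -dinclC nabla_val [in LHS]met_sym.
    rewrite -val_d1 dw !nabla_val -!valD; congr (val _).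
    (* Paired with u, metric compatibility and the symmetric Hessian give (u,d(w,da)) = (nabla_u
       w,da) + (u,nabla_w da), while torsion freeness gives (u,i_{da} dw) = (u,nabla_{da} w) -
       (da,nabla_u w). *)
    apply: met_nondeg => u; rewrite !(linear_funD (met_linear u)).
    rewrite nabla_metric nabla_exact_sym.
    have -> : met u (to_form1 (\i_(d1 Om a) (d (val w)))) =
        met u (nabla1 nabla (d1 Om a) w) - met (d1 Om a) (nabla1 nabla u w).
      by apply: (@dincl_inj _ _ Om); rewrite nabla_tors -interior_val -dw.
    rewrite [met (d1 Om a) _]met_sym.
    by rewrite addrA [LHS](ACl (2*3*(1*4)))%AC /= subrr addr0.
(* The correction sums of [divergence_defect] and [lie_perp] cancel, leaving half of twice nabla_w
   y. *)
rewrite /constructed_nabla perpE divergence_defect -addrA lie_perp.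
rewrite -addrA [X in _ + X]addrCA addNr addr0 -mulr2n -scaler_nat scalerA.
by rewrite mulVf // scale1r.
Qed.

End Covariant.
End Inverse.
End Metric.
End Classical.
End Forms.

Theorem proposition2p9 (k : fieldType) (A : algType k) (Om : dga A)
    (g : seq (form1 Om * form1 Om)) (met : form1 Om -> form1 Om -> A)
    (nabla : form1 Om -> Om -> Om) :
  2%N \notin [pchar k] ->
  dga_classical Om ->
  symmetric_tensor g ->
  metric_bilinear met ->
  metric_inverse met g ->
  covariant_derivative met nabla ->
  acts_by_derivations nabla ->
  metric_compatible met nabla ->
  torsion_free met nabla ->
  [/\ degm1_classical (divergence met g nabla),
      associated_metric (divergence met g nabla) met
    & forall (w : form1 Om) (y : Om),
        constructed_nabla met (divergence met g nabla) w y = nabla w y].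
Proof.
rewrite inE /= => two_neq0 clOm g_sym met_bilin g_inv cov der comp tors.
split; [split | |].
- exact: divergence_degm1.
- by exists (interior met); apply: divergence_classical_interior.
- by move=> a x; apply: divergence_sq_lact.
- exact: divergence_associated.
- by move=> w y; apply: constructed_nablaE.
Qed.
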